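(* Let $K$ be any field. Then there exists a locally nilpotent $K$-algebra $R$ and a ($K$-linear) derivation $D$ of $R$ such that $R[X;D]$ is not Jacobson radical, i.e. $J(R[X;D])\neq R[X;D]$.
   Context: A ring is locally nilpotent if every finitely generated subring is nilpotent. For a derivation $D$ of $R$, $R[X;D]$ is the ring of polynomials $\sum a_iX^i$, $a_i\in R$, with pointwise addition and multiplication determined by $X^iX^j=X^{i+j}$ and $Xa=aX+D(a)$. $J(\cdot)$ denotes the Jacobson radical. *)

(* Defs.v *)
(* Non-unital K-algebras are modelled as an lmodType K
   together with a bilinear associative multiplication (MathComp rings are unital). *)
From HB Require Import structures.
From mathcomp Require Import all_boot all_order all_algebra.
Set Implicit Arguments. Unset Strict Implicit. Unset Printing Implicit Defensive.
Import GRing.Theory.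
Local Open Scope ring_scope.

Definition nu_algebra (K : fieldType) (R : lmodType K) (mul : R -> R -> R) : Prop :=
  [/\ (forall x y z, mul x (mul y z) = mul (mul x y) z),
      (forall x y z, mul (x + y) z = mul x z + mul y z),
      (forall x y z, mul x (y + z) = mul x y + mul x z),
      (forall (a : K) x y, mul (a *: x) y = a *: mul x y) &
      (forall (a : K) x y, mul x (a *: y) = a *: mul x y)].

Inductive gen_subring (R : zmodType) (mul : R -> R -> R) (s : seq R) : R -> Prop :=
  | gs_in x : x \in s -> gen_subring mul s x
  | gs_zero : gen_subring mul s 0
  | gs_opp x : gen_subring mul s x -> gen_subring mul s (- x)
  | gs_add x y : gen_subring mul s x -> gen_subring mul s y -> gen_subring mul s (x + y)
  | gs_mul x y : gen_subring mul s x -> gen_subring mul s y -> gen_subring mul s (mul x y).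

(* A subring A is nilpotent: A^(N+1) = 0, i.e. all products of N+1 elements of A vanish *)
Definition nilpotent_sub (R : zmodType) (mul : R -> R -> R) (A : R -> Prop) : Prop :=
  exists N : nat, forall (x : R) (l : seq R), size l = N -> A x ->
    (forall y, y \in l -> A y) -> foldl mul x l = 0.

Definition locally_nilpotent (R : zmodType) (mul : R -> R -> R) : Prop :=
  forall s : seq R, nilpotent_sub mul (gen_subring mul s).

Definition derivation (K : fieldType) (R : lmodType K) (mul : R -> R -> R) (D : R -> R) : Prop :=
  (forall (a : K) x y, D (a *: x + y) = a *: D x + D y) /\
  (forall x y, D (mul x y) = mul (D x) y + mul x (D y)).

(* Elements of R[X;D]: coefficient sequences s (s`_i = coefficient of X^i);
   trailing zeros allowed, equality is coefficientwise. *)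
Definition ore_add (R : zmodType) (s t : seq R) : seq R :=
  mkseq (fun n => s`_n + t`_n) (maxn (size s) (size t)).
Definition ore_opp (R : zmodType) (s : seq R) : seq R := map (fun x => - x) s.
Definition ore_mulz (R : zmodType) (s : seq R) (m : int) : seq R := map (fun x => x *~ m) s.
(* (a X^i)(b X^j) = sum_k C(i,k) a D^k(b) X^(i+j-k), from X b = b X + D b *)
Definition ore_mul (R : zmodType) (mul : R -> R -> R) (D : R -> R) (s t : seq R) : seq R :=
  mkseq (fun n => \sum_(i < size s) \sum_(j < size t)
                    \sum_(k < i.+1 | (i + j)%N == (n + k)%N)
                      mul s`_i (iter k D t`_j) *+ 'C(i, k))
        (size s + size t).

Definition ore_rqr (R : zmodType) (mul : R -> R -> R) (D : R -> R) (a : seq R) : Prop :=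
  exists b : seq R, forall n : nat,
    (ore_add a (ore_add b (ore_opp (ore_mul mul D a b))))`_n = 0.

(* Jacobson radical of the non-unital ring R[X;D]: a is in J iff the right ideal
   generated by a, {a m + a r : m in Z, r in R[X;D]}, is right quasi-regular *)
Definition ore_jacobson (R : zmodType) (mul : R -> R -> R) (D : R -> R) (a : seq R) : Prop :=
  forall (m : int) (r : seq R), ore_rqr mul D (ore_add (ore_mulz a m) (ore_mul mul D a r)).

(* Main.v *)
(* The Ore extension R[X;D] acts on the space of functions f(i, e) of a position
   i and of exponents e : nat -> nat.  Level v is "active" at i when the v-th
   ternary digit of i is 1, so that passing from i to i+1 enters or leaves
   exactly one level, and the level-v intervals are nested inside the
   intervals of higher levels.  Read on words, the generator x moves i to i+1,
   while X acts at position i as 1 - sum of u_v over the active levels v, where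
   u_v raises e_v by 1.  Hence D^k(x) = [X, [X, ..., x]] contributes u_v^k when
   entering level v and (-u_v)^k when leaving it, and x may leave level v only
   when e_v equals a prescribed quota, tending to infinity with v.

   R is generated by the D^k(x).  A long product of generators with k < m
   traverses a complete interval of some level v with quota at least 2m; it
   raises e_v by at most 2(m-1) there, hence vanishes: R is locally nilpotent.
   On the other hand x X is not right quasi-regular: the X's let the innermost
   active exponent grow by 1 at each position, and the quota of v is chosen as
   the number of positions of a level-v interval at which v is innermost, so
   that exactly one term survives in (x X)^n for every n. *)
Require Import Defs.
From HB Require Import structures.
From mathcomp Require Import all_boot all_order all_algebra.
From mathcomp Require Import boolp functions.
From mathcomp Require Import zify ring.
Import GRing.Theory.
Set Implicit Arguments. Unset Strict Implicit. Unset Printing Implicit Defensive.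
Local Open Scope ring_scope.

(** * Ternary digits: active levels, quotas and target exponents *)

Section Ternary.
Local Open Scope nat_scope.

Definition active (v i : nat) : bool := (i %/ 3 ^ v) %% 3 == 1.
(** The number of trailing digits 2 of [i]: adding 1 turns them into 0 and raises the digit at place
    [level i] from 0 to 1 (entering) or from 1 to 2 (leaving). *)
Definition level (i : nat) : nat := logn 3 i.+1.

Lemma expn3_gt0 v : 0 < 3 ^ v. Proof. by rewrite expn_gt0. Qed.

Lemma ltn_expn3 v : v < 3 ^ v. Proof. exact: ltn_expl. Qed.

Lemma dvdn_level j i : (3 ^ j %| i.+1) = (j <= level i).
Proof. by rewrite pfactor_dvdn. Qed.

Lemma divnS_level j i : i.+1 %/ 3 ^ j = (j <= level i) + i %/ 3 ^ j.
Proof. by rewrite divnS ?expn3_gt0 // dvdn_level. Qed.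

Lemma modnS_level j i : level i < j -> i.+1 %% 3 ^ j = (i %% 3 ^ j).+1.
Proof. by move=> lt_j; rewrite modnS dvdn_level leqNgt lt_j. Qed.

Lemma dvdn3_div_level j i : j <= level i ->
  (3 %| i.+1 %/ 3 ^ j) = (j < level i).
Proof.
move=> le_j; rewrite -dvdn_level in le_j.
by rewrite -dvdn_level expnSr -[X in _ = (_ %| X)](divnK le_j) mulnC dvdn_pmul2r
           ?expn3_gt0.
Qed.

Lemma active_lt_level j i : j < level i -> (active j i = false) * (active j i.+1 = false).
Proof.
move=> lt_j; have := dvdn3_div_level (ltnW lt_j).
rewrite lt_j /active divnS_level (ltnW lt_j) => h; split; lia.
Qed.

Lemma active_gt_level j i : level i < j -> active j i.+1 = active j i.
Proof. by move=> lt_j; rewrite /active divnS_level leqNgt lt_j. Qed.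

Lemma active_level i : active (level i) i = ~~ active (level i) i.+1.
Proof.
have := @dvdn3_div_level (level i) i (leqnn _).
rewrite /active divnS_level leqnn ltnn => h; lia.
Qed.

Lemma active_geF v i : i < 3 ^ v -> active v i = false.
Proof. by move=> h; rewrite /active divn_small. Qed.

Lemma active_ltn v i : active v i -> v < i.
Proof.
case: (ltnP v i) => // le_i; rewrite active_geF //.
exact: leq_ltn_trans le_i (ltn_expn3 v).
Qed.

Lemma active_modn k j i : active k (i %% 3 ^ j) = (k < j) && active k i.
Proof.
case: (ltnP k j) => [lt_k|le_j] /=; last first.
  apply: active_geF; apply: leq_trans (ltn_pmod _ (expn3_gt0 j)) _.
  by rewrite leq_exp2l.
rewrite /active {2}(divn_eq i (3 ^ j)).
have -> : 3 ^ j = 3 ^ (j - k).-1 * 3 * 3 ^ k.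
  by rewrite -expnSr -expnD; congr (3 ^ _); lia.
by rewrite mulnA divnMDl ?expn3_gt0 // mulnA modnMDl.
Qed.

Definition inactive (i : nat) : bool := ~~ has (active^~ i) (iota 0 i).

Lemma inactiveP i : reflect (forall k, active k i = false) (inactive i).
Proof.
apply: (iffP hasPn) => [h k|h k _]; last by rewrite h.
apply/negP => ak; have := h k; rewrite ak mem_iota /= add0n active_ltn //.
by move/(_ isT).
Qed.

Definition ninactive (t : nat) : nat := count inactive (iota 0 t).

Lemma ninactiveS t : ninactive t.+1 = ninactive t + inactive t.
Proof. by rewrite /ninactive -addn1 iotaD count_cat /= addn0. Qed.

Lemma leq_ninactive s t : s <= t -> ninactive s <= ninactive t.
Proof.
move/subnKC <-; elim: (t - s) => [|d IH]; first by rewrite addn0.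
by rewrite addnS ninactiveS; apply: leq_trans IH (leq_addr _ _).
Qed.

Lemma inactive_pred_expn3 v : inactive (3 ^ v).-1.
Proof.
apply/inactiveP => k; case: (ltnP k v) => [lt_k|le_v].
  have lev : level (3 ^ v).-1 = v by rewrite /level prednK ?expn3_gt0 // pfactorK.
  by have [] := @active_lt_level k (3 ^ v).-1; rewrite ?lev.
apply: active_geF; have := expn3_gt0 v; have : 3 ^ v <= 3 ^ k by rewrite leq_exp2l.
lia.
Qed.

(** A position below [3 ^ v] encodes the lower digits inside a level-[v] interval, and [v] is
    innermost there when none of them is 1. *)
Definition quota (v : nat) : nat := ninactive (3 ^ v).

Lemma quota_gt v : v < quota v.
Proof.
elim: v => [|v IH] //; rewrite /quota.
have e : (3 ^ v.+1).-1.+1 = 3 ^ v.+1 by rewrite prednK ?expn3_gt0.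
(* All digits of [(3 ^ v.+1).-1] are 2, so it is an inactive position not yet counted in
   [quota v]. *)
rewrite -e ninactiveS inactive_pred_expn3 addn1 ltnS.
apply: leq_trans IH (leq_ninactive _).
by have := expn3_gt0 v; rewrite expnS; lia.
Qed.

(* The value of e_j at position i along the only surviving path. *)
Definition target (i j : nat) : nat := ninactive (i %% 3 ^ j).+1.

Lemma target_level i : target i (level i) = quota (level i).
Proof.
rewrite /target /quota; congr ninactive; apply/eqP.
rewrite eqn_leq ltn_pmod ?expn3_gt0 //=; apply: dvdn_leq => //.
have : 3 ^ level i %| i.+1 by rewrite dvdn_level.
by rewrite {2}(divn_eq i (3 ^ level i)) -addnS dvdn_addr // dvdn_mull.
Qed.

Lemma targetS_level i : target i.+1 (level i) = 1.
Proof.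
have : 3 ^ level i %| i.+1 by rewrite dvdn_level.
by rewrite /target /dvdn => /eqP ->.
Qed.

Lemma targetS i j : level i < j ->
  target i.+1 j = target i j + inactive (i.+1 %% 3 ^ j).
Proof.
by move=> lt_j; rewrite /target ninactiveS modnS_level.
Qed.

Lemma inactive_modn i j :
  reflect (forall k, k < j -> active k i = false) (inactive (i %% 3 ^ j)).
Proof.
apply: (iffP (inactiveP _)) => [h k lt_k|h k].
  by have := h k; rewrite active_modn lt_k.
by rewrite active_modn; case: (ltnP k j) => //= /h.
Qed.

Lemma active_neq_level j i : j != level i -> active j i.+1 = active j i.
Proof.
rewrite neq_ltn => /orP[/active_lt_level [-> ->] //|]; exact: active_gt_level.
Qed.

End Ternary.

(** * Updates of a single exponent *)

Section Exponents.
Local Open Scope nat_scope.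

Definition upd (e : nat -> nat) (v k : nat) : nat -> nat :=
  fun j => if j == v then k else e j.
Definition inc (e : nat -> nat) (v : nat) : nat -> nat := upd e v (e v).+1.

Lemma updE e v k : upd e v k v = k. Proof. by rewrite /upd eqxx. Qed.

Lemma upd_neq e v k j : j != v -> upd e v k j = e j.
Proof. by rewrite /upd => /negPf ->. Qed.

Lemma inc_neq e v j : j != v -> inc e v j = e j.
Proof. exact: upd_neq. Qed.

Lemma inc_upd e v k : inc (upd e v k) v = upd e v k.+1.
Proof. by apply/funext => j; rewrite /inc /upd eqxx; case: eqP. Qed.

Lemma upd_inc e v k : upd (inc e v) v k = upd e v k.
Proof. by apply/funext => j; rewrite /inc /upd; case: eqP. Qed.

Lemma upd_incC e v k j : j != v -> upd (inc e j) v k = inc (upd e v k) j.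
Proof.
move=> jv; apply/funext => l; rewrite /inc /upd (negPf jv).
by case: (l =P v) => // ->; rewrite eq_sym (negPf jv).
Qed.

End Exponents.

(** * The operators X and D^k(x), and the vanishing of long words *)

Section Operators.
Variable K : fieldType.

Definition opspace := nat -> (nat -> nat) -> K^o.

Definition opX (f : opspace) : opspace :=
  fun i e => f i e - \sum_(v < i | active v i) f i (inc e v).

(* [opx k] is D^k(x); [upd] on entering level v erases whatever e_v was before. *)
Definition opx (k : nat) (f : opspace) : opspace := fun i e =>
  let v := level i in
  if active v i.+1 then f i.+1 (upd e v k)
  else if (e v + k == quota v)%N then (-1) ^+ k * f i.+1 (upd e v 0%N) else 0.

Lemma opXE n f i e : (i <= n)%N ->
  opX f i e = f i e - \sum_(v < n | active v i) f i (inc e v).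
Proof.
move=> le_i; rewrite /opX; congr (_ - _).
rewrite (big_ord_widen_cond n (active^~ i) (fun v => f i (inc e v)) le_i).
apply: eq_bigl => v; case: (boolP (active v i)) => //= av.
by rewrite active_ltn.
Qed.

(** Levels other than [level i] are active at both [i] and [i.+1] or at neither, so their terms
    cancel. The term of [level i] occurs on one side only: after the move on entering, before it on
    leaving, whence the sign. *)
Lemma opX_opx k f i e : opX (opx k f) i e - opx k (opX f) i e = opx k.+1 f i e.
Proof.
rewrite (opXE _ _ (leqnSn i)) /opx /=; set v := level i.
have av := active_level i; rewrite -/v in av.
case: ifPn => act; rewrite act /= in av.
  rewrite /opX [X in _ - (_ - X)](bigD1 (Ordinal (active_ltn act))) //= inc_upd.
  rewrite (eq_bigl (fun j : 'I_i.+1 => active j i.+1 && (j != Ordinal (active_ltn act)))).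
    rewrite (eq_bigr (fun j : 'I_i.+1 => f i.+1 (inc (upd e v k) j))).
      by rewrite opprB [LHS]addrC addrA addrNK addrK.
    by move=> j /andP[_ jv]; rewrite upd_incC.
  move=> j; rewrite -val_eqE /= -/v.
  case: (eqVneq (j : nat) v) => [->|jv]; first by rewrite av andbF.
  by rewrite andbT active_neq_level.
have ltv : (v < i.+1)%N by rewrite ltnS ltnW // active_ltn.
rewrite (bigD1 (Ordinal ltv)) //= {1}/inc updE upd_inc.
set S := \sum_(_ < _ | _) _.
have -> : S = if (e v + k == quota v)%N then
   (-1) ^+ k * \sum_(j < i.+1 | active j i.+1) f i.+1 (inc (upd e v 0) j) else 0.
  rewrite /S (eq_bigl (fun j : 'I_i.+1 => active j i.+1)); last first.
    move=> j; rewrite -val_eqE /= -/v.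
    case: (eqVneq (j : nat) v) => [->|jv]; first by rewrite (negPf act) andbF.
    by rewrite andbT active_neq_level.
  rewrite mulr_sumr; case: ifP => eqq.
    apply: eq_bigr => j aj.
    have vj : v != j by apply: contraNneq act => ->.
    by rewrite inc_neq // eqq upd_incC // eq_sym.
  rewrite big1 // => j aj.
  have vj : v != j by apply: contraNneq act => ->.
  by rewrite inc_neq // eqq.
(* Raising [e v] and then leaving with [k] meets the same quota test as leaving with [k.+1]. *)
rewrite addSnnS /opX exprS mulN1r mulNr.
have cancel3 (a b c : K) : a - (b + c) - (a - c) = - b by ring.
case: (e v + k == _)%N; case: (e v + k.+1 == _)%N.
- by rewrite mulrBr cancel3.
- by rewrite mulrBr cancel3 oppr0.
- by rewrite sub0r addr0 subr0.
- by rewrite !(subr0, addr0).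
Qed.

Definition lin_op (F : opspace -> opspace) : Prop :=
  forall (c : K) f g, F (c *: f + g) = c *: F f + F g.

Lemma opspaceE (c : K) (f g : opspace) i e : (c *: f + g) i e = c * f i e + g i e.
Proof. by []. Qed.

Lemma opx_lin k : lin_op (opx k).
Proof.
move=> c f g; apply/funext => i; apply/funext => e.
rewrite opspaceE /opx; case: ifP => // _; case: ifP => _; last by rewrite mulr0 addr0.
by rewrite opspaceE mulrDr mulrCA.
Qed.

Lemma opX_lin : lin_op opX.
Proof.
move=> c f g; apply/funext => i; apply/funext => e.
rewrite opspaceE /opX opspaceE mulrBr mulr_sumr addrACA -opprD -big_split.
by [].
Qed.

Definition word (w : seq nat) : opspace -> opspace := foldr (fun k F => opx k \o F) id w.

Lemma opx_eq0 k f i : (forall e, f i.+1 e = 0) -> forall e, opx k f i e = 0.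
Proof. by move=> h e; rewrite /opx !h mulr0 !if_same. Qed.

Lemma word_cat w1 w2 : word (w1 ++ w2) = word w1 \o word w2.
Proof. by elim: w1 => //= k w1 ->. Qed.

Lemma word_eq0 w f i : (forall e, f (i + size w)%N e = 0) -> forall e, word w f i e = 0.
Proof.
elim: w i => [|k w IH] i /=; first by rewrite addn0.
by move=> h; apply: opx_eq0; apply: IH => e; rewrite addSnnS.
Qed.

(** The word is long enough to leave the current level-[v] interval. Until then only lower levels
    change and [e v] stays put; leaving would need [e v + k = quota v] with both summands below
    [m]. *)
Lemma word_exit m v w f i e :
    (m.*2 <= quota v)%N -> all (fun k => k < m)%N w -> active v i ->
    (e v < m)%N -> (3 ^ v <= size w + i %% 3 ^ v)%N -> word w f i e = 0.
Proof.
move=> qv; elim: w i e => [|k w IH] i e /=.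
  by move=> _ _ _; rewrite add0n leqNgt ltn_pmod ?expn3_gt0.
move=> /andP[km wm] av ev sz; rewrite /opx.
have := active_level i; case: (eqVneq (level i) v) => [->|lv].
  rewrite av => /esym/negPf ->; case: eqP => // eqq; lia.
move=> _; have av' : active v i.+1 by rewrite active_neq_level // eq_sym.
have lt_v : (level i < v)%N.
  rewrite ltn_neqAle lv leqNgt; apply/negP => /active_lt_level[].
  by rewrite av.
have sz' : (3 ^ v <= size w + i.+1 %% 3 ^ v)%N.
  by rewrite modnS_level // addnS -addSn.
by rewrite !IH ?mulr0 ?if_same // upd_neq // eq_sym.
Qed.

(** From any start a level-[v] interval is entered within [2 * 3 ^ v.+1] steps, with letters left to
    traverse it. Entering sets [e v] to a letter below [m], so [word_exit] applies. *)
Lemma word_long m v w f : (m.*2 <= quota v)%N -> all (fun k => k < m)%N w ->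
  (3 * 3 ^ v.+1 <= size w)%N -> word w f = 0.
Proof.
move=> qv wm sz; apply/funext => i; apply/funext.
(* In the next block of length [3 ^ v.+1], the position whose digit [v] is 1 and whose lower digits
   are 0. *)
pose p := ((i %/ 3 ^ v.+1).+1 * 3 ^ v.+1 + 3 ^ v)%N.
have p_i : (i < p)%N.
  by rewrite /p; have := ltn_ceil i (expn3_gt0 v.+1); lia.
have p_le : (p <= i + 2 * 3 ^ v.+1)%N.
  by rewrite /p; have := leq_trunc_div i (3 ^ v.+1); rewrite expnS; lia.
(* The first [s] letters lead to [p.-1]; the next one enters level [v]. *)
pose s := (p - i).-1.
have ps : p = (i + s).+1 by rewrite /s; lia.
have v0 := expn3_gt0 v; rewrite expnS in sz p_le.
have lt_s : (s < size w)%N by lia.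
have pd : (3 ^ v %| p)%N.
  by rewrite /p dvdn_add // expnS mulnA dvdn_mull.
have ap : active v p.
  rewrite /active /p divnDr // divnn expn3_gt0 expnS mulnA mulnK //.
  by rewrite modnMDl.
have lv : level (i + s) = v.
  apply/eqP; rewrite eqn_leq -dvdn_level -ps pd andbT leqNgt.
  by apply/negP => /active_lt_level[_]; rewrite -ps ap.
rewrite -(cat_take_drop s w) word_cat => e /=.
apply: word_eq0; rewrite size_takel ?(ltnW lt_s) // => {}e.
rewrite (drop_nth 0%N lt_s) /= /opx lv -ps ap.
apply: (word_exit (m := m) (v := v)) => //.
- by apply/allP => k /mem_drop; move/allP: wm; apply.
- by rewrite updE; apply: (allP wm); rewrite mem_nth.
by rewrite size_drop (eqP pd) addn0; lia.
Qed.

End Operators.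

(** * The algebra spanned by words, and the commutator with X *)

Section Algebra.
Variable K : fieldType.

Local Notation operator := (opspace K -> opspace K).

(** [m] bounds the letters and [n] bounds the lengths from below: products add the lengths, the
    derivation raises only [m]. *)
Inductive wspan (m n : nat) : operator -> Prop :=
| wspan0 : wspan m n 0
| wspan_cons c w F : all (fun k => k < m)%N w -> (n <= size w)%N ->
    wspan m n F -> wspan m n (c *: @word K w + F).

Lemma wspanZD m n c F G : wspan m n F -> wspan m n G -> wspan m n (c *: F + G).
Proof.
move=> sF sG; elim: sF => [|d w F' wm wn _ IH]; first by rewrite scaler0 add0r.
by rewrite scalerDr scalerA -addrA; apply: wspan_cons.
Qed.

Lemma wspanZ m n c F : wspan m n F -> wspan m n (c *: F).
Proof. by move=> sF; rewrite -[_ *: _]addr0; apply: wspanZD => //; apply: wspan0. Qed.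

Lemma wspanD m n F G : wspan m n F -> wspan m n G -> wspan m n (F + G).
Proof. by move=> sF sG; rewrite -[F]scale1r; apply: wspanZD. Qed.

Lemma wspan_word m n w : all (fun k => k < m)%N w -> (n <= size w)%N ->
  wspan m n (@word K w).
Proof.
by move=> wm wn; rewrite -[@word K w]addr0 -[@word K w]scale1r; apply: wspan_cons => //; apply: wspan0.
Qed.

Lemma wspan_mono m m' n n' F : (m <= m')%N -> (n' <= n)%N -> wspan m n F -> wspan m' n' F.
Proof.
move=> mm nn; elim=> [|c w G wm wn _ IH]; first exact: wspan0.
apply: wspan_cons => //; last exact: leq_trans wn.
by apply: sub_all wm => k km; apply: leq_trans mm.
Qed.

Lemma word_lin w : lin_op (@word K w).
Proof. by elim: w => [|k w IH] c f g //=; rewrite IH opx_lin. Qed.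

Lemma wspan_lin m n F : wspan m n F -> lin_op F.
Proof.
elim=> [|c w G _ _ _ IH] d f g; first by rewrite scaler0 addr0.
have E u : (c *: @word K w + G) u = c *: word w u + G u by [].
rewrite !E IH word_lin !scalerDr !scalerA mulrC addrACA.
by [].
Qed.

Lemma lin_op0 (F : operator) : lin_op F -> F 0 = 0.
Proof. by move=> /(_ (- 1) 0 0); rewrite scaler0 addr0 scaleN1r addNr. Qed.

Lemma lin_opD (F : operator) f g : lin_op F -> F (f + g) = F f + F g.
Proof. by move=> /(_ 1 f g); rewrite !scale1r. Qed.

Lemma lin_opB (F : operator) f g : lin_op F -> F (f - g) = F f - F g.
Proof. by move=> /(_ (- 1) g f); rewrite !scaleN1r addrC [RHS]addrC. Qed.

Lemma lin_op_sum (F : operator) I (r : seq I) (P : pred I) (f : I -> opspace K) :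
  lin_op F -> F (\sum_(i <- r | P i) f i) = \sum_(i <- r | P i) F (f i).
Proof.
by move=> lF; apply: (big_morph F); [move=> ? ?; apply: lin_opD|apply: lin_op0].
Qed.

Lemma lin_opMn (F : operator) f n : lin_op F -> F (f *+ n) = F f *+ n.
Proof.
move=> lF; elim: n => [|n IH]; first by rewrite !mulr0n lin_op0.
by rewrite !mulrS lin_opD // IH.
Qed.

Lemma wspan_word_comp m n n' w F : all (fun k => k < m)%N w -> (n <= size w)%N ->
  wspan m n' F -> wspan m (n + n') (@word K w \o F).
Proof.
move=> wm wn; elim=> [|c w' G w'm w'n _ IH].
  have -> : @word K w \o (0 : operator) = 0 :> operator; last exact: wspan0.
  by apply/funext => f; apply: (lin_op0 (@word_lin w)).
have -> : @word K w \o (c *: @word K w' + G) = c *: @word K (w ++ w') + (@word K w \o G).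
  by apply/funext => f; rewrite word_cat; exact: (@word_lin w c (word w' f) (G f)).
by apply: wspan_cons; rewrite ?all_cat ?wm // size_cat leq_add.
Qed.

Lemma wspan_comp m n n' F G : wspan m n F -> wspan m n' G -> wspan m (n + n') (F \o G).
Proof.
move=> sF sG; elim: sF => [|c w F' wm wn _ IH]; first exact: wspan0.
have -> : (c *: @word K w + F') \o G = c *: (@word K w \o G) + (F' \o G) by [].
by apply: wspanZD => //; apply: wspan_word_comp.
Qed.

Lemma wspan_long m : exists n, forall F, wspan m n F -> F = 0.
Proof.
(* Level [m.*2] is used in [word_long], since its quota exceeds [m.*2]. *)
exists (3 * 3 ^ m.*2.+1)%N => F; elim=> // c w G wm wn _ ->.
rewrite addr0; have -> : @word K w = 0; last by rewrite scaler0.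
by apply/funext => f; apply: (word_long _ (ltnW (quota_gt m.*2)) wm wn).
Qed.

(** Finite reach: each word looks ahead by exactly its length. *)
Lemma wspan_local m n F : wspan m n F -> exists L : nat, forall (f : opspace K) i,
  (forall j e, (i <= j <= i + L)%N -> f j e = 0) -> forall e, F f i e = 0.
Proof.
elim=> [|c w G wm wn _ [L hL]]; first by exists 0%N.
exists (maxn (size w) L) => f i hf e.
have -> : (c *: @word K w + G) f i e = c * word w f i e + G f i e by [].
rewrite hL ?addr0; last first.
  move=> j e' /andP[ij jL]; apply: hf; rewrite ij (leq_trans jL) //.
  by rewrite leq_add2l leq_maxr.
rewrite word_eq0 ?mulr0 // => e'; apply: hf.
by rewrite leq_addr leq_add2l leq_maxl.
Qed.

Definition ad (F : operator) : operator := (@opX K \o F) - (F \o @opX K).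

Lemma adE F f : ad F f = opX (F f) - F (opX f). Proof. by []. Qed.

Lemma adZD c F G : ad (c *: F + G) = c *: ad F + ad G.
Proof.
apply/funext => f.
have -> : (c *: ad F + ad G) f = c *: ad F f + ad G f by [].
rewrite !adE scalerBr.
have E u : (c *: F + G) u = c *: F u + G u by [].
by rewrite !E opX_lin opprD addrACA.
Qed.

Lemma ad_comp F G : lin_op F -> ad (F \o G) = (ad F \o G) + (F \o ad G).
Proof.
move=> lF; apply/funext => f.
have -> : ((ad F \o G) + (F \o ad G)) f = ad F (G f) + F (ad G f) by [].
by rewrite !adE (lin_opB (opX (G f)) (G (opX f)) lF) addrA addrNK.
Qed.

Lemma ad_opx k : ad (@opx K k) = @opx K k.+1.
Proof.
apply/funext => f; apply/funext => i; apply/funext => e.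
exact: opX_opx.
Qed.

(** By the Leibniz rule, one letter at a time grows by 1 and the length is kept. *)
Lemma wspan_ad_word m w : all (fun k => k < m)%N w -> wspan m.+1 (size w) (ad (@word K w)).
Proof.
elim: w => [_|k w IH /= /andP[km wm]].
  have -> : ad (@word K [::]) = 0 by apply/funext => f; rewrite adE subrr.
  exact: wspan0.
have lt_mS j : (j < m -> j < m.+1)%N by move=> /ltnW.
rewrite ad_comp; last exact: opx_lin.
rewrite ad_opx; apply: wspanD.
  by apply: (@wspan_word _ _ (k.+1 :: w)) => //=; rewrite ltnS km (sub_all lt_mS).
by apply: (@wspan_word_comp _ 1 _ [:: k]); rewrite /= ?lt_mS //; apply: IH.
Qed.

Lemma wspan_ad m n F : wspan m n F -> wspan m.+1 n (ad F).
Proof.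
elim=> [|c w G wm wn _ IH].
  have -> : ad 0 = 0; last exact: wspan0.
  apply/funext => f; rewrite adE lin_op0 ?subrr //; exact: opX_lin.
rewrite adZD; apply: wspanZD => //.
by apply: wspan_mono (wspan_ad_word wm).
Qed.

(** Length at least 1 keeps the identity out, which nilpotency requires; the letter bound may vary
    with the element. *)
Definition alg_pred : {pred operator} := fun F => `[< exists m, wspan m 1 F >].

Lemma alg_predP F : reflect (exists m, wspan m 1 F) (F \in alg_pred).
Proof. exact: asboolP. Qed.

Lemma alg_pred_closed : submod_closed alg_pred.
Proof.
split=> [|c F G /alg_predP[m sF] /alg_predP[m' sG]].
  by apply/alg_predP; exists 0%N; apply: wspan0.
apply/alg_predP; exists (maxn m m'); apply: wspanZD.
  by apply: wspan_mono sF; rewrite ?leq_maxl.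
by apply: wspan_mono sG; rewrite ?leq_maxr.
Qed.

HB.instance Definition _ := GRing.isSubmodClosed.Build K operator alg_pred alg_pred_closed.

Record alg := Alg { alg_val : operator; _ : alg_val \in alg_pred }.

HB.instance Definition _ := [isSub for alg_val].
HB.instance Definition _ := [Choice of alg by <:].
HB.instance Definition _ := [SubChoice_isSubLmodule of alg by <:].

End Algebra.

(** * Local nilpotency, and the action of R[X;D] on functions *)

Section Counterexample.
Variable K : fieldType.

Local Notation R := (alg K).

Lemma algP (x : R) : exists m, wspan m 1 (alg_val x).
Proof. by case: x => F /= /alg_predP. Qed.

Lemma alg_val_lin (x : R) : lin_op (alg_val x).
Proof. by have [m /wspan_lin] := algP x. Qed.

Lemma alg_val_inj : injective (@alg_val K). Proof. exact: val_inj. Qed.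

Lemma alg_valD (x y : R) f : alg_val (x + y) f = alg_val x f + alg_val y f.
Proof. by []. Qed.

Lemma alg_valMn (x : R) n f : alg_val (x *+ n) f = alg_val x f *+ n.
Proof. by elim: n => [|n IH]; rewrite ?mulr0n // !mulrS alg_valD IH. Qed.

Lemma alg_val_sum I (r : seq I) (P : pred I) (x : I -> R) f :
  alg_val (\sum_(i <- r | P i) x i) f = \sum_(i <- r | P i) alg_val (x i) f.
Proof. by apply: (big_morph (fun y : R => alg_val y f)). Qed.

Lemma alg_mul_subproof (x y : R) : alg_val x \o alg_val y \in @alg_pred K.
Proof.
have [m sx] := algP x; have [m' sy] := algP y.
apply/alg_predP; exists (maxn m m').
apply: (@wspan_mono _ (maxn m m') _ 2) => //; apply: (@wspan_comp _ _ 1 1).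
  by apply: wspan_mono sx; rewrite ?leq_maxl.
by apply: wspan_mono sy; rewrite ?leq_maxr.
Qed.
Definition alg_mul (x y : R) : R := Alg (alg_mul_subproof x y).

Lemma alg_ad_subproof (x : R) : ad (alg_val x) \in @alg_pred K.
Proof. by have [m sx] := algP x; apply/alg_predP; exists m.+1; apply: wspan_ad. Qed.
Definition alg_ad (x : R) : R := Alg (alg_ad_subproof x).

Lemma alg_mulE x y f : alg_val (alg_mul x y) f = alg_val x (alg_val y f).
Proof. by []. Qed.

Lemma alg_adE x f : alg_val (alg_ad x) f = opX (alg_val x f) - alg_val x (opX f).
Proof. by []. Qed.

Lemma alg_eqP (x y : R) : alg_val x =1 alg_val y -> x = y.
Proof. by move=> /funext/alg_val_inj. Qed.

Lemma alg_valZ c (x : R) f : alg_val (c *: x) f = c *: alg_val x f.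
Proof. by []. Qed.

Lemma alg_nu_algebra : nu_algebra alg_mul.
Proof.
split=> [x y z|x y z|x y z|a x y|a x y]; apply: alg_eqP => f //.
  by rewrite alg_mulE alg_valD (lin_opD _ _ (@alg_val_lin x)).
rewrite alg_mulE !alg_valZ -[_ *: alg_val y f]addr0 alg_val_lin.
by rewrite (lin_op0 (@alg_val_lin x)) addr0.
Qed.

Lemma alg_ad_derivation : derivation alg_mul alg_ad.
Proof.
split=> [a x y|x y]; apply: alg_eqP => f.
  rewrite alg_valD alg_valZ !alg_adE !alg_valD !alg_valZ opX_lin [in RHS]scalerBr opprD.
  by rewrite [LHS]addrACA.
rewrite alg_valD !alg_mulE !alg_adE !alg_mulE.
by rewrite (lin_opB (opX (alg_val y f)) (alg_val y (opX f)) (@alg_val_lin x)) addrA addrNK.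
Qed.

Lemma alg_foldl_mul m n x l : wspan m n (alg_val x) ->
  (forall y, y \in l -> wspan m 1 (alg_val y)) ->
  wspan m (n + size l) (alg_val (foldl alg_mul x l)).
Proof.
elim: l x n => [|y l IH] x n sx sl /=; first by rewrite addn0.
rewrite -addSnnS -addn1; apply: IH.
  by apply: wspan_comp => //; apply: sl; rewrite mem_head.
by move=> z zl; apply: sl; rewrite in_cons zl orbT.
Qed.

Lemma alg_common_span (s : seq R) :
  exists m, forall x, x \in s -> wspan m 1 (alg_val x).
Proof.
elim: s => [|x s [m IH]]; first by exists 0%N.
have [m' sx] := algP x; exists (maxn m m') => y.
rewrite in_cons => /orP[/eqP ->|/IH sy].
  by apply: wspan_mono sx; rewrite ?leq_maxr.
by apply: wspan_mono sy; rewrite ?leq_maxl.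
Qed.

Lemma alg_locally_nilpotent : locally_nilpotent alg_mul.
Proof.
move=> s; have [m sm] := alg_common_span s.
(* Products concatenate words, so the bound [m] of the generators serves the whole subring. *)
have gen_span x : gen_subring alg_mul s x -> wspan m 1 (alg_val x).
  elim=> {x} [x /sm //| |x _ sx|x y _ sx _ sy|x y _ sx _ sy].
  - exact: wspan0.
  - have -> : alg_val (- x) = (- 1) *: alg_val x by rewrite scaleN1r.
    exact: wspanZ.
  - exact: (wspanD sx sy).
  - by apply: (@wspan_mono _ m _ 2) => //; apply: (@wspan_comp _ _ 1 1).
have [n hn] := wspan_long K m; exists n => x l sl /gen_span sx gl.
apply: alg_val_inj; apply: hn; rewrite -sl.
apply: (@wspan_mono _ m _ (1 + size l)) => //; apply: alg_foldl_mul => // y yl.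
exact/gen_span/gl.
Qed.

Lemma iter_opX_lin i : lin_op (iter i (@opX K)).
Proof. by elim: i => [|i IH] c f g //=; rewrite IH opX_lin. Qed.

Lemma opX_alg (x : R) f : opX (alg_val x f) = alg_val (alg_ad x) f + alg_val x (opX f).
Proof. by rewrite addrNK. Qed.

(** The rule X^i a = sum_k C(i,k) D^k(a) X^(i-k) behind [ore_mul], here for operators. *)
Lemma iter_opX_alg i (x : R) f :
  iter i (@opX K) (alg_val x f) =
  \sum_(k < i.+1) alg_val (iter k alg_ad x) (iter (i - k) (@opX K) f) *+ 'C(i, k).
Proof.
pose G k l : opspace K := alg_val (iter k alg_ad x) (iter l (@opX K) f).
rewrite -[LHS]/(iter i (@opX K) (G 0%N 0%N)) -[RHS]/(\sum_(k < i.+1) G k (i - k)%N *+ 'C(i, k)).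
elim: i => [|i IH]; first by rewrite big_ord1.
rewrite [LHS]/= IH (lin_op_sum _ _ _ (@opX_lin K)).
have GX k l : opX (G k l) = G k.+1 l + G k l.+1 by rewrite /G opX_alg.
rewrite (eq_bigr (fun k : 'I_i.+1 => G k.+1 (i - k)%N *+ 'C(i, k) +
                     G k (i.+1 - k)%N *+ 'C(i, k))); last first.
  move=> k _; rewrite (lin_opMn _ _ (@opX_lin K)) GX mulrnDl subSn //.
  by rewrite -ltnS.
rewrite big_split /= [RHS]big_ord_recl /=.
(* Pascal's rule, once the term k = 0 is split off. *)
rewrite [in RHS](eq_bigr (fun k : 'I_i.+1 => G k.+1 (i - k)%N *+ 'C(i, k) +
                     G k.+1 (i - k)%N *+ 'C(i, k.+1))); last first.
  by move=> k _; rewrite /= /bump /= add1n subSS binS addnC mulrnDr.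
rewrite big_split /= [RHS]addrCA; congr (_ + _).
have e : \sum_(k < i.+2) G k (i.+1 - k)%N *+ 'C(i, k) =
         \sum_(k < i.+1) G k (i.+1 - k)%N *+ 'C(i, k).
  by rewrite big_ord_recr /= bin_small // mulr0n addr0.
rewrite -e big_ord_recl /= !bin0; congr (_ + _).
Qed.

(** X acts as [opX]; by [ore_act_mul] products become compositions, so a quasi-inverse yields an
    identity between operators. *)
Definition ore_act (s : seq R) (f : opspace K) : opspace K :=
  \sum_(i < size s) alg_val s`_i (iter i (@opX K) f).

Lemma ore_act_widen n s f : (size s <= n)%N ->
  ore_act s f = \sum_(i < n) alg_val s`_i (iter i (@opX K) f).
Proof.
move=> le_n; rewrite /ore_act (big_ord_widen n (fun i => alg_val s`_i (iter i (@opX K) f))) //.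
rewrite big_mkcond; apply: eq_bigr => i _; case: ltnP => // le_s.
by rewrite nth_default.
Qed.

Lemma ore_act_eq0 s f : (forall n, s`_n = 0) -> ore_act s f = 0.
Proof. by move=> s0; apply: big1 => i _; rewrite s0. Qed.

Lemma ore_act_add s t f : ore_act (ore_add s t) f = ore_act s f + ore_act t f.
Proof.
set n := maxn (size s) (size t).
rewrite (@ore_act_widen n s) ?leq_maxl // (@ore_act_widen n t) ?leq_maxr //.
rewrite (@ore_act_widen n) ?size_mkseq // -big_split; apply: eq_bigr => i _.
by rewrite nth_mkseq.
Qed.

Lemma ore_act_opp s f : ore_act (ore_opp s) f = - ore_act s f.
Proof.
rewrite /ore_act size_map -sumrN; apply: eq_bigr => i _.
by rewrite (nth_map 0).
Qed.

Lemma ore_act_mul s t f :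
  ore_act (ore_mul alg_mul alg_ad s t) f = ore_act s (ore_act t f).
Proof.
set N := (size s + size t)%N.
pose T i j k n : opspace K :=
  alg_val s`_i (alg_val (iter k alg_ad t`_j) (iter n (@opX K) f)) *+ 'C(i, k).
transitivity (\sum_(n < N) \sum_(i < size s) \sum_(j < size t)
    \sum_(k < i.+1 | (i + j == n + k)%N) T i j k n).
  rewrite /ore_act size_mkseq; apply: eq_bigr => n _.
  rewrite nth_mkseq // alg_val_sum; apply: eq_bigr => i _.
  rewrite alg_val_sum; apply: eq_bigr => j _.
  by rewrite alg_val_sum; apply: eq_bigr => k _; rewrite alg_valMn.
rewrite exchange_big /=; apply: eq_bigr => i _.
rewrite exchange_big /= /ore_act.
rewrite (lin_op_sum _ _ _ (@iter_opX_lin i)) (lin_op_sum _ _ _ (@alg_val_lin _)).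
apply: eq_bigr => j _.
rewrite iter_opX_alg (lin_op_sum _ _ _ (@alg_val_lin _)).
(* For given [i], [j], [k] the exponent is forced: n = i + j - k. *)
rewrite (exchange_big_dep predT) //=; apply: eq_bigr => k _.
have lt_n : (i + j - k < N)%N.
  exact: leq_ltn_trans (leq_subr _ _) (leq_add (ltn_ord i) (ltnW (ltn_ord j))).
have le_k : (k <= i)%N by rewrite -ltnS.
rewrite (big_pred1 (Ordinal lt_n)) /=; last first.
  by move=> n /=; rewrite -val_eqE /=; lia.
rewrite /T (lin_opMn _ _ (@alg_val_lin _)) -iterD; congr (alg_val _ (alg_val _ (iter _ _ _)) *+ _).
by lia.
Qed.

End Counterexample.

(** * The surviving path of exponents and the states that lag behind it *)

Section Trajectory.
Local Open Scope nat_scope.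

Definition on_target (i : nat) (e : nat -> nat) : Prop :=
  forall j, active j i -> e j = target i j.

(* Such a state can never catch up: the innermost exponents already consume
   all the positions at which the exponent j would have to grow. *)
Definition below_target (i : nat) (e : nat -> nat) : Prop :=
  exists j, [/\ active j i, e j < target i j &
    forall k, k < j -> active k i -> e k = target i k].

Lemma incE e c j : inc e c j = e j + (j == c).
Proof. by rewrite /inc /upd; case: eqP => [->|]; rewrite ?addn1 ?addn0. Qed.

(** The target obeys the law of motion: reset the level just changed, then raise the innermost
    active level [c]. For higher [j], the lower digits of [i.+1] contain no 1 exactly when j = c. *)
Lemma target_next i c j : active c i.+1 -> (forall k, active k i.+1 -> c <= k) ->
  active j i.+1 -> target i.+1 j = upd (target i) (level i) 0 j + (j == c).
Proof.
move=> ac minc aj; have le_j : level i <= j.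
  by rewrite leqNgt; apply/negP => /active_lt_level[_]; rewrite aj.
rewrite /upd; case: (eqVneq j (level i)) => [ej|nj].
  rewrite ej targetS_level; case: eqP => // nc.
  have : c < level i by rewrite -ej ltn_neqAle minc // ej andbT eq_sym; apply/eqP.
  by move=> /active_lt_level[_]; rewrite ac.
rewrite targetS; last by rewrite ltn_neqAle eq_sym nj.
congr (_ + nat_of_bool _); apply/inactive_modn/eqP => [h|-> k lt_k].
  apply/eqP; rewrite eqn_leq minc // andbT leqNgt.
  by apply/negP => /h; rewrite ac.
by apply/negP => /minc; rewrite leqNgt lt_k.
Qed.

Lemma on_target_next i c e : active c i.+1 -> (forall k, active k i.+1 -> c <= k) ->
  on_target i e -> on_target i.+1 (inc (upd e (level i) 0) c).
Proof.
move=> ac minc h j aj; rewrite incE (target_next ac minc aj) /upd.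
by case: eqVneq => // nj; rewrite h // -active_neq_level.
Qed.

(** Exponent and target get the same update, so the deficit at [j] persists; [j] is not the level
    being left, which has met its target. *)
Lemma below_target_next i c e : active c i.+1 -> (forall k, active k i.+1 -> c <= k) ->
  below_target i e -> (active (level i) i -> e (level i) = target i (level i)) ->
  below_target i.+1 (inc (upd e (level i) 0) c).
Proof.
move=> ac minc [j [aj lt_j h]] hv.
have nj : j != level i.
  by apply/eqP => ej; move: lt_j; rewrite ej hv ?ltnn // -ej.
exists j; split; first by rewrite active_neq_level.
  by rewrite incE (target_next ac minc) ?active_neq_level // ltn_add2r !upd_neq.
move=> k lt_k ak; rewrite incE (target_next ac minc ak) /upd.
by case: eqVneq => // nk; rewrite h // -active_neq_level.
Qed.

(** Before X acts, [c] still lacks a unit, so any term of X that does not raise [c] is deficient. *)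
Lemma ltn_target_next i c e : active c i.+1 -> (forall k, active k i.+1 -> c <= k) ->
  on_target i e \/ below_target i e ->
  (active (level i) i -> e (level i) = target i (level i)) ->
  upd e (level i) 0 c < target i.+1 c.
Proof.
move=> ac minc h hv; rewrite (target_next ac minc ac) eqxx addn1 ltnS /upd.
case: eqVneq => // nc; have aci : active c i by rewrite -active_neq_level.
case: h => [->//|[j [aj lt_j hj]]].
have [lt_c|lt_c|->] := ltngtP c j; [by rewrite hj| |exact: ltnW].
(* A deficient [j] inside [c] would stay active at [i.+1], against the minimality of [c]. *)
have nj : j != level i.
  by apply/eqP => ej; move: lt_j; rewrite ej hv ?ltnn // -ej.
by have := minc j; rewrite active_neq_level // aj leqNgt lt_c => /(_ isT).
Qed.

End Trajectory.

(** * x X is not right quasi-regular *)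

Section NotQuasiRegular.
Variable K : fieldType.

Local Notation R := (alg K).

Lemma opx0_on_target (F : opspace K) i e :
  (active (level i) i -> e (level i) = target i (level i)) ->
  opx 0 F i e = F i.+1 (upd e (level i) 0%N).
Proof.
rewrite /opx active_level; case: ifPn => // _ ->//.
by rewrite addn0 target_level eqxx expr0 mul1r.
Qed.

Lemma opx0_below (F : opspace K) i e : active (level i) i ->
  (e (level i) < target i (level i))%N -> opx 0 F i e = 0.
Proof.
rewrite /opx active_level => /negPf ->.
by rewrite target_level addn0 ltn_neqAle => /andP[/negPf ->].
Qed.

(** * The equation g = delta_n + x X g, solved backwards from n *)

Section Resolvent.
Variables (g : opspace K) (n : nat).
Hypothesis g_small : forall i e, (n < i)%N -> g i e = 0.
Hypothesis gE : forall i e, g i e = (i == n)%:R + opx 0 (opX g) i e.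
Hypothesis n_inactive : inactive n.

Definition resolvent_claim i : Prop :=
  (forall e, on_target i e -> g i e != 0) /\ (forall e, below_target i e -> g i e = 0).

(** Every term of X other than the one raising [c] leaves [e c] deficient with no active level
    inside [c], so the claim kills it. *)
Lemma opX_first i c e : resolvent_claim i -> active c i ->
  (forall k, active k i -> c <= k)%N -> (e c < target i c)%N ->
  opX g i e = - g i (inc e c).
Proof.
move=> [_ below] ac minc lt_c.
have below0 e' : e' c = e c -> g i e' = 0.
  move=> ec; apply: below; exists c; split=> //; first by rewrite ec.
  by move=> k lt_k /minc; rewrite leqNgt lt_k.
rewrite /opX below0 // sub0r (bigD1 (Ordinal (active_ltn ac))) //= big1 ?addr0 //.
by move=> j /andP[_ nj]; apply: below0; rewrite inc_neq // eq_sym.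
Qed.

Lemma resolvent_claim_next i : (i < n)%N -> resolvent_claim i.+1 -> resolvent_claim i.
Proof.
move=> lt_i IH.
have gi e : g i e = opx 0 (opX g) i e by rewrite gE ltn_eqF // add0r.
(* Without an active level at [i.+1], X acts there as the identity. *)
have [exc|none] := pselect (exists c, active c i.+1); last first.
  have none' k : active k i.+1 = false by apply/negP => ak; apply: none; exists k.
  have gX e : opX g i.+1 e = g i.+1 e.
    by rewrite /opX big1 ?subr0 // => j; rewrite none'.
  split=> e h; rewrite gi.
    rewrite opx0_on_target; last exact: h.
    by rewrite gX; apply: IH.1 => j; rewrite none'.
  have [j [aj lt_j _]] := h.
  case: (eqVneq j (level i)) => [ej|nj]; first by rewrite opx0_below // -ej.
  by move: aj; rewrite -active_neq_level // none'.
case: (ex_minnP exc) => c ac minc.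
have step e : on_target i e \/ below_target i e ->
    (active (level i) i -> e (level i) = target i (level i)) ->
    g i e = - g i.+1 (inc (upd e (level i) 0%N) c).
  move=> h hv; rewrite gi opx0_on_target //; apply: opX_first => //.
  exact: ltn_target_next.
split=> e h.
  rewrite step ?oppr_eq0; [|by left|exact: h].
  by apply: IH.1; apply: on_target_next.
(* Either a level left at [i] has met its target and the deficit lies elsewhere, or it falls short
   and x cannot leave it. *)
have [hv|] := pselect (active (level i) i -> e (level i) = target i (level i)).
  by rewrite step //; [rewrite IH.2 ?oppr0 //; apply: below_target_next|right].
move=> hv; rewrite gi; have [j [aj lt_j hj]] := h.
have av : active (level i) i by apply/negPn/negP => nav; apply: hv => av; rewrite av in nav.
have ej : j = level i.
  have [lt_v|lt_v|//] := ltngtP j (level i).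
    by have := active_lt_level lt_v; rewrite aj; case.
  by case: hv => _; apply: hj.
by rewrite opx0_below // -ej.
Qed.

Lemma resolvent_neq0 e : g 0%N e != 0.
Proof.
have claim d : (d <= n)%N -> resolvent_claim (n - d).
  elim: d => [_|d IH lt_d].
    rewrite subn0; split=> e'; last first.
      by case=> j [aj _ _]; move/inactiveP: n_inactive => /(_ j); rewrite aj.
    move=> _; rewrite gE eqxx opx_eq0 ?addr0 ?oner_neq0 // => e''.
    by rewrite /opX big1 ?subr0 => [|j _]; rewrite g_small.
  apply: resolvent_claim_next; first by lia.
  by have -> : (n - d.+1).+1 = (n - d)%N by [lia]; apply: IH; apply: ltnW.
have := claim n (leqnn n); rewrite subnn => -[h _]; apply: h => j.
by rewrite active_geF // expn3_gt0.
Qed.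

End Resolvent.

Lemma gen_subproof : @opx K 0 \in @alg_pred K.
Proof. by apply/alg_predP; exists 1%N; apply: (@wspan_word K 1 1 [:: 0%N]). Qed.
Definition gen : R := Alg gen_subproof.

Lemma ore_act_gen f : ore_act [:: 0; gen] f = opx 0 (opX f).
Proof. by rewrite /ore_act big_ord_recl big_ord1 add0r. Qed.

Lemma ore_act_local (s : seq R) : exists L : nat, forall (f : opspace K) i,
  (forall j e, (i <= j <= i + L)%N -> f j e = 0) -> forall e, ore_act s f i e = 0.
Proof.
have [L hL] : exists L : nat, forall x, x \in s -> forall (f : opspace K) i,
    (forall j e, (i <= j <= i + L)%N -> f j e = 0) -> forall e, alg_val x f i e = 0.
  elim: s => [|x s [L IH]]; first by exists 0%N.
  have [m /wspan_local[L' hL']] := algP x; exists (maxn L L') => y.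
  rewrite in_cons => /orP[/eqP ->|ys] f i hf e.
    apply: hL' => j e' /andP[ij jL]; apply: hf; rewrite ij (leq_trans jL) //.
    by rewrite leq_add2l leq_maxr.
  apply: (IH y ys) => j e' /andP[ij jL]; apply: hf; rewrite ij (leq_trans jL) //.
  by rewrite leq_add2l leq_maxl.
exists L => f i hf e; rewrite /ore_act.
have -> : (\sum_(k < size s) alg_val s`_k (iter k (@opX K) f)) i e =
          \sum_(k < size s) alg_val s`_k (iter k (@opX K) f) i e.
  by apply: (big_morph (fun h : opspace K => h i e)).
apply: big1 => k _; apply: hL => [|j e' ij]; first exact: mem_nth.
elim: (k : nat) e' => [|l IH] e' /=; first exact: hf.
by rewrite /opX IH big1 ?subr0 // => v _; rewrite IH.
Qed.

Lemma gen_not_jacobson : ~ ore_jacobson (@alg_mul K) (@alg_ad K) [:: 0; gen].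
Proof.
move=> /(_ 1 [::])[b hb].
have hact f : ore_act b f = opx 0 (opX (ore_act b f)) - opx 0 (opX f).
  have := ore_act_eq0 f hb; set a := ore_add (ore_mulz _ _) _.
  have aE h : ore_act a h = opx 0 (opX h).
    rewrite /a ore_act_add ore_act_mul -ore_act_gen.
    have -> : ore_act [::] h = 0 by rewrite /ore_act big_ord0.
    have -> : ore_act [:: 0; gen] 0 = 0.
      by rewrite ore_act_gen (lin_op0 (@opX_lin K)) (lin_op0 (@opx_lin K 0)).
    by rewrite addr0.
  clearbody a; rewrite !ore_act_add ore_act_opp ore_act_mul !aE addrA => /eqP.
  by rewrite subr_eq0 => /eqP <-; rewrite [RHS]addrC addKr.
have [L hL] := ore_act_local b.
pose n := (3 ^ L.+1).-1.
have lt_n : (L < n)%N by rewrite /n; have := ltn_expn3 L; rewrite expnS; lia.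
pose f : opspace K := fun i _ => (i == n)%:R.
pose g : opspace K := f - ore_act b f.
have gval i e : g i e = (i == n)%:R - ore_act b f i e by [].
have g0 : g 0%N (fun=> 0%N) = 0.
  rewrite gval hL; last first.
    by move=> j e; rewrite add0n /= => le_j; rewrite /f ltn_eqF // (leq_ltn_trans le_j).
  by rewrite subr0 eq_sym gtn_eqF // (leq_ltn_trans _ lt_n).
move/eqP: g0; apply/negP; apply: (@resolvent_neq0 g n).
- move=> i e lt_i; rewrite gval gtn_eqF // hL ?subrr // => j e' /andP[ij _].
  by rewrite /f gtn_eqF // (leq_trans lt_i).
- move=> i e; rewrite gval {1}hact.
  have -> : opx 0 (opX g) = opx 0 (opX f) - opx 0 (opX (ore_act b f)).
    by rewrite (lin_opB f (ore_act b f) (@opX_lin K)) (lin_opB _ _ (@opx_lin K 0)).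
  by congr (_ + _); apply: opprB.
- exact: inactive_pred_expn3.
Qed.

End NotQuasiRegular.

Theorem mainTheorem11 (K : fieldType) :
  exists (R : lmodType K) (mul : R -> R -> R),
    nu_algebra mul /\ locally_nilpotent mul /\
    exists D : R -> R, derivation mul D /\
      exists a : seq R, ~ ore_jacobson mul D a.
Proof.
exists (alg K), (@alg_mul K); split; first exact: alg_nu_algebra.
split; first exact: alg_locally_nilpotent.
exists (@alg_ad K); split; first exact: alg_ad_derivation.
by exists [:: 0; gen K]; apply: gen_not_jacobson.
Qed.
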